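(* Let $A=(a_{ik})$ be a real symmetric $n\times n$ matrix whose induced signed graph $\Gamma=(T,\sigma)$, $T=(V,E)$, has no cycle. Let $\lambda_k$ be the $k$-th eigenvalue of $A$, of multiplicity $r$, with $$\lambda_1\le\cdots\le\lambda_{k-1}<\lambda_k=\cdots=\lambda_{k+r-1}<\lambda_{k+r}\le\cdots\le\lambda_n$$ (the strict inequalities being vacuous when the corresponding index is out of range), and let $f_k$ be an eigenfunction for $\lambda_k$. Let $\mathcal{F}=\{x\in V: f_k(x)=0\text{ and }f_k(y)=0\text{ for all }y\sim x\}$, let $\overline{\mathfrak{S}}(f_k)$ be the number of strong nodal domains of $f_k$ on $-\Gamma=(T,-\sigma)$, and let $\tilde r$ be the multiplicity of $\lambda_k$ as an eigenvalue of the matrix $\widetilde A$ obtained from $A$ by deleting all rows and columns with indices in $\mathcal F$. Then $r\ge\tilde r$ and there are nonnegative integers $c_1,c_2$ with $c_1+c_2+(r-\tilde r)=|\mathcal F|$ such that $$\mathfrak{S}(f_k)=k+r-1-|\mathcal F|+c_1,\qquad \overline{\mathfrak{S}}(f_k)=n-k+1-|\mathcal F|+c_2.$$ In particular, when $\mathcal F=\emptyset$, $\mathfrak{S}(f_k)=k+r-1$ and $\overline{\mathfrak{S}}(f_k)=n-k+1$.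
   Context: The induced signed graph of a real symmetric $n\times n$ matrix $A$ has vertex set $V=\{x_1,\dots,x_n\}$ (identified with indices), edge $\{x_i,x_j\}$ iff $i\ne j$ and $a_{ij}\ne0$, and sign $\sigma_{x_ix_j}=-a_{ij}/|a_{ij}|$. Eigenvalues are listed with multiplicity in nondecreasing order; eigenfunctions are nonzero eigenvectors viewed as functions on $V$. A walk is $y_1,\dots,y_m$ ($m\ge2$) with consecutive vertices adjacent; for $f:V\to\mathbb R$ and a signature $\sigma$, an S-walk is a walk with $f(y_j)\sigma_{y_jy_{j+1}}f(y_{j+1})>0$ for all $j$. The strong nodal domains of $f$ on $(T,\sigma)$ are the induced subgraphs on the equivalence classes of the relation on $\{x:f(x)\ne0\}$ ''$x=y$ or an S-walk connects $x$ and $y$''; $\mathfrak{S}(f)$ denotes their number on $\Gamma=(T,\sigma)$. *)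

(* Defs.v *)
From HB Require Import structures.
From mathcomp Require Import all_boot all_order all_algebra.
From mathcomp Require Import reals.
Set Implicit Arguments. Unset Strict Implicit. Unset Printing Implicit Defensive.
Import Order.TTheory GRing.Theory Num.Theory.
Local Open Scope ring_scope.

Definition adj (R : realType) (n : nat) (A : 'M[R]_n) : rel 'I_n :=
  fun i j => (i != j) && (A i j != 0).

Definition sgn_edge (R : realType) (n : nat) (A : 'M[R]_n) (i j : 'I_n) : R :=
  - (A i j) / `|A i j|.

Definition no_cycle (n : nat) (e : rel 'I_n) : Prop :=
  ~ exists s : seq 'I_n, [/\ uniq s, (2 < size s)%N & cycle e s].

Definition Sstep (R : realType) (n : nat) (e : rel 'I_n)
  (sigma : 'I_n -> 'I_n -> R) (f : 'I_n -> R) : rel 'I_n :=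
  fun x y => e x y && (0 < f x * sigma x y * f y).

Definition strong_nodal_count (R : realType) (n : nat) (e : rel 'I_n)
  (sigma : 'I_n -> 'I_n -> R) (f : 'I_n -> R) : nat :=
  #|[set [set y | connect (Sstep e sigma f) x y] | x in [set x | f x != 0]]|.

Definition principal_submx (R : realType) (n : nat) (A : 'M[R]_n)
  (S : {set 'I_n}) : 'M[R]_#|S| :=
  \matrix_(i, j) A (enum_val i) (enum_val j).

(* Main.v *)
Require Import Defs.
From HB Require Import structures.
From mathcomp Require Import all_boot all_order all_algebra.
From mathcomp Require Import reals.
From mathcomp Require Import ring zify.
Set Implicit Arguments. Unset Strict Implicit. Unset Printing Implicit Defensive.
Import Order.TTheory GRing.Theory Num.Theory.
Local Open Scope ring_scope.

(* Put M = A - lam, g = f_k, N = {g <> 0}, and let T be the complement of F.  A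
flow (antisymmetric function on edges) without divergence on a forest is zero.
Applied to M_xy (g_x h_y - h_x g_y) this shows that every h in the kernel of the
submatrix of M on T vanishes off N and is proportional to g along edges, and,
comparing the ranks of the T x N block of M and of its transpose, that this kernel
has dimension c - |T \ N|, c being the number of components of N.  Applied to a
difference of a flow along the edges with M_xy g_x g_y < 0 (joining the domains
counted by S) and one along those with M_xy g_x g_y > 0 (for Sbar) it gives
S + Sbar = |N| + c.  Hence S + Sbar = n - |F| + rt.

On the Sbar-dimensional space of vectors supported in N and proportional to g along
the edges with M_xy g_x g_y > 0, the form of M is -1/2 sum M_xy g_x g_y (h_x/g_x - h_y/g_y)^2 >= 0.
It meets the (k+r-1)-dimensional sum of eigenspaces of A for eigenvalues <= lam only
inside the kernel of M restricted to vectors supported in N, of dimension rt, so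
k + r - 1 + Sbar <= n + rt.  Symmetrically n - k + 1 + S <= n + rt.  The theorem is
arithmetic from these three relations and rt <= r. *)

(** * Cycles and flows in forests *)

(** A longest simple path cannot be extended beyond its first vertex [x], so another neighbour [z]
    of [x] already lies on it, and the segment up to [z] closes to a cycle. *)
Lemma min_degree2_cycle (T : finType) (e : rel T) (x0 y0 : T) :
  symmetric e -> irreflexive e -> e x0 y0 ->
  (forall x y, e x y -> exists2 z, z != x & e y z) ->
  exists s : seq T, [/\ uniq s, (2 < size s)%N & cycle e s].
Proof.
move=> e_sym e_irr e00 deg2.
pose P m := [exists t : m.+2.-tuple T, uniq t && sorted e t].
have exP : exists m, P m.
  exists 0%N; apply/existsP; exists [tuple x0; y0].
  rewrite /= inE e00 !andbT.
  by apply: contraTneq e00 => ->; rewrite e_irr.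
have ubP m : P m -> (m <= #|T|)%N.
  case/existsP=> t /andP[ut _]; have := max_card [in t].
  rewrite (card_uniqP ut) size_tuple; apply: leq_trans; exact: leqW.
case: (ex_maxnP exP ubP) => m /existsP[[t size_t] /= /andP[]].
case: t size_t => [|x [|y p]] //= size_t ut; rewrite -/(path e y p) => /andP[exy pt] max_m.
have [z zy exz] : exists2 z, z != y & e x z by apply: deg2; rewrite e_sym.
have zx : z != x by apply: contraTneq exz => ->; rewrite e_irr.
have [zp|zNp] := boolP (z \in p); last first.
  suff /max_m : P m.+1 by rewrite ltnn.
  have sz : size [:: z, x, y & p] == m.+3 by [].
  apply/existsP; exists (Tuple sz) => /=.
  by rewrite ut !inE negb_or zx negb_or zy zNp e_sym exz exy.
case/splitPr: zp pt ut => p1 p2; rewrite cat_path /= => /and3P[pp1 ez _] ut.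
exists [:: x, y & rcons p1 z]; split.
- rewrite -cat_rcons in ut.
  have : uniq ([:: x, y & rcons p1 z] ++ p2) by [].
  by rewrite cat_uniq => /andP[].
- by rewrite /= size_rcons.
by rewrite /= exy !rcons_path /= last_rcons pp1 ez e_sym.
Qed.

(* A vertex carrying flow carries it along at least two edges, so the support
of a nonzero flow would contain a cycle. *)
Lemma forest_flow_eq0 (R : realFieldType) (n : nat) (e : rel 'I_n)
    (w : 'I_n -> 'I_n -> R) :
  no_cycle e -> irreflexive e ->
  (forall x y, w y x = - w x y) -> (forall x y, w x y != 0 -> e x y) ->
  (forall x, \sum_y w x y = 0) -> forall x y, w x y = 0.
Proof.
move=> acyclic e_irr w_anti we w_sum x y; apply/eqP/negPn/negP => wxy; apply: acyclic.
pose e' : rel 'I_n := fun x y => w x y != 0.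
have [|||s [us ss cs]] := @min_degree2_cycle _ e' x y _ _ wxy.
- by move=> a b; rewrite /e' w_anti oppr_eq0.
- by move=> a; apply/negbTE/negP => waa; have := we _ _ waa; rewrite e_irr.
- move=> a b wab; apply/exists_inP; apply: contraT.
  rewrite negb_exists_in => /forall_inP w0.
  have := w_sum b; rewrite (bigD1 a) //= big1 ?addr0 => [wba|c ca].
    by move: wab; rewrite /e' w_anti wba oppr0 eqxx.
  by have := w0 c ca; rewrite negbK => /eqP.
by exists s; split=> //; apply: sub_cycle cs => a b; apply: we.
Qed.

(** * Eigenspaces of symmetric matrices over a real field *)

Lemma mulmx_trmx_eq0 (R : realFieldType) (m n : nat) (A : 'M[R]_(m, n)) :
  A *m A^T = 0 -> A = 0.
Proof.
move=> AA0; apply/matrixP => i j; rewrite mxE.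
have /eqP := congr1 (fun B : 'M_m => B i i) AA0; rewrite !mxE psumr_eq0.
  by move=> /allP/(_ j); rewrite mem_index_enum mxE mulf_eq0 orbb => /(_ isT)/eqP.
by move=> k _; rewrite mxE; exact: sqr_ge0.
Qed.

Lemma form_ge0 (R : realFieldType) (n : nat) (v : 'rV[R]_n) :
  0 <= (v *m v^T) 0 0.
Proof. by rewrite mxE; apply: sumr_ge0 => i _; rewrite mxE; exact: sqr_ge0. Qed.

Lemma form_eq0 (R : realFieldType) (n : nat) (v : 'rV[R]_n) :
  (v *m v^T) 0 0 = 0 -> v = 0.
Proof. by move=> v0; apply: mulmx_trmx_eq0; rewrite [LHS]mx11_scalar v0 raddf0. Qed.

Lemma symmetric_sqr_ker (R : realFieldType) (m n : nat) (A : 'M[R]_n)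
    (B : 'M[R]_(m, n)) :
  A^T = A -> B *m A *m A = 0 -> B *m A = 0.
Proof.
move=> A_sym BAA; apply: mulmx_trmx_eq0.
by rewrite trmx_mul A_sym mulmxA BAA mul0mx.
Qed.

(* [K] spans the kernel and [I] an invariant complement on which [A - a] acts
invertibly. *)
Lemma mup_char_poly_block (F : fieldType) (d p n : nat) (A : 'M[F]_n) (a : F)
    (K : 'M[F]_(d, n)) (I : 'M[F]_(p, n)) (C : 'M[F]_p) :
  (d + p)%N = n -> row_free (col_mx K I) ->
  K *m (A - a%:M) = 0 -> I *m (A - a%:M) = C *m I -> C \in unitmx ->
  mup a (char_poly A) = d.
Proof.
move=> dp; case: n / dp in A K I *.
rewrite row_free_unit => Punit K0 IC Cu.
pose P := col_mx K I; pose D : 'M_(d + p) := block_mx a%:M 0 0 (C + a%:M).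
have PA : P *m A = D *m P.
  rewrite /P /D mul_col_mx mul_block_col !mul0mx addr0 add0r mulmxDl.
  move/eqP: K0; rewrite mulmxBr subr_eq0 => /eqP ->.
  move/eqP: IC; rewrite mulmxBr subr_eq => /eqP ->.
  by rewrite !mul_scalar_mx !mul_mx_scalar.
have -> : char_poly A = ('X - a%:P) ^+ d * char_poly (C + a%:M).
  have mapP : map_mx polyC P \in unitmx by rewrite map_unitmx.
  have eqPD : map_mx polyC P *m char_poly_mx A = char_poly_mx D *m map_mx polyC P.
    rewrite /char_poly_mx mulmxBr mulmxBl -!map_mxM PA.
    by rewrite scalar_mxC.
  have detP : \det (map_mx polyC P) != 0.
    by move: mapP; rewrite unitmxE; apply: contraTneq => ->; rewrite unitr0.
  have : char_poly A = char_poly D.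
    apply: (mulfI detP); rewrite /char_poly -det_mulmx eqPD det_mulmx.
    exact: mulrC.
  move->; rewrite /char_poly /char_poly_mx map_block_mx /= !map_mx0.
  rewrite (@scalar_mx_block _ d p) opp_block_mx add_block_mx !oppr0 !addr0.
  by rewrite det_ublock map_scalar_mx -raddfB det_scalar.
(* [a] is not a root of the second factor, because [C] is invertible. *)
rewrite mupMl ?mup_XsubCX ?eqxx // -eigenvalue_root_char.
apply/eigenvalueP => -[v /eqP]; rewrite mulmxDr mul_mx_scalar -subr_eq0 addrK.
by move/eqP => vC; apply/negP/negPn; rewrite -(mulmxK Cu v) vC mul0mx.
Qed.

(** By [symmetric_sqr_ker] the kernel and the row space of [A - a] meet trivially, hence are
    complementary; [C] is the action of [A - a] on the row space. *)
Lemma mup_char_poly_symmetric (R : realFieldType) (n : nat) (A : 'M[R]_n) (a : R) :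
  A^T = A -> mup a (char_poly A) = \rank (eigenspace A a).
Proof.
move=> A_sym; pose N := A - a%:M.
have N_sym : N^T = N by rewrite /N linearB /= A_sym tr_scalar_mx.
pose I := row_base N; pose C := I *m N *m pinvmx I.
have IN : I *m N = C *m I.
  by rewrite mulmxKpV // eq_row_base submxMl.
have vI m (v : 'M_(m, _)) : v *m I *m N = 0 -> v *m I = 0.
  have [B ->] : exists B, I = B *m N by apply/submxP; rewrite eq_row_base.
  move=> vBNN; have {}vBNN : v *m B *m N *m N = 0 by rewrite -[v *m B *m N]mulmxA.
  by rewrite mulmxA; exact: symmetric_sqr_ker N_sym vBNN.
have vI0 m (v : 'M_(m, _)) : v *m I = 0 -> v = 0.
  by move=> vI0; apply: (row_free_inj (row_base_free N)); rewrite vI0 mul0mx.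
have Cu : C \in unitmx.
  rewrite -row_free_unit -kermx_eq0; apply/eqP/vI0/vI.
  by rewrite -mulmxA IN mulmxA mulmx_ker mul0mx.
apply: (@mup_char_poly_block _ _ _ _ A a (row_base (kermx N)) I C) => //.
- by rewrite mxrank_ker subnK ?rank_leq_row.
- rewrite -kermx_eq0 -submx0; apply/rV_subP => u /sub_kermxP.
  rewrite -[u]hsubmxK mul_row_col => uP.
  have r0 : rsubmx u = 0.
    apply/vI0/vI; move: (congr1 (mulmx^~ N) uP); rewrite mul0mx mulmxDl.
    rewrite -(mulmxA (lsubmx u)) (_ : row_base (kermx N) *m N = 0) ?mulmx0 ?add0r //.
    by apply/sub_kermxP; rewrite eq_row_base.
  move: uP; rewrite r0 mul0mx addr0 => uP.
  have -> : lsubmx u = 0.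
    by apply: (row_free_inj (row_base_free (kermx N))); rewrite uP mul0mx.
  by rewrite row_mx0 sub0mx.
- by apply/sub_kermxP; rewrite eq_row_base.
Qed.

Lemma sum_count_undup (R : realFieldType) (s : seq R) (P : pred R) :
  (\sum_(i < size (undup s) | P ((undup s)`_i)%R)
    count_mem ((undup s)`_i)%R s)%N = count P s.
Proof.
rewrite -sum1_count -(big_undup_iterop_count _ s) (big_nth 0) big_mkord.
by apply: eq_bigr => i _; rewrite Monoid.iteropE /= iter_addn_0 mul1n.
Qed.

Lemma eigenspace_orthogonal (R : realFieldType) (n : nat) (A : 'M[R]_n) (a b : R)
    (u v : 'rV[R]_n) :
  A^T = A -> a != b -> u *m A = a *: u -> v *m A = b *: v -> u *m v^T = 0.
Proof.
move=> A_sym ab uA vA; have : (a - b) *: (u *m v^T) = 0.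
  by rewrite scalerBl scalemxAl -uA scalemxAr -linearZ /= -vA trmx_mul A_sym mulmxA subrr.
by move/eqP; rewrite scaler_eq0 subr_eq0 (negPf ab) => /eqP.
Qed.

(** [W] is the sum of the eigenspaces with [s * (a - lam) <= 0]. These are mutually orthogonal, so
    on [W] the scaled form is a sum of nonpositive terms; if it is nonnegative, every term vanishes
    and only the [lam] component survives. *)
Lemma semidefinite_subspace (R : realFieldType) (n : nat) (A : 'M[R]_n)
    (eigs : seq R) (s lam : R) :
  A^T = A -> char_poly A = \prod_(x <- eigs) ('X - x%:P) -> s != 0 ->
  exists W : 'M[R]_n, (count (fun a => s * (a - lam) <= 0)%R eigs <= \rank W)%N /\
    forall v : 'rV_n, (v <= W)%MS ->
      0 <= s * (v *m (A - lam%:M) *m v^T) 0 0 -> v *m (A - lam%:M) = 0.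
Proof.
move=> A_sym Aeigs s0; set t := undup eigs.
pose P (i : 'I_(size t)) := s * (t`_i - lam) <= 0.
(* Indexing by distinct eigenvalues makes the sum direct; [sum_count_undup] restores the
   multiplicities. *)
have t_inj : {in P &, injective (fun i : 'I_(size t) => t`_i)}.
  move=> i j _ _ /eqP; rewrite nth_uniq ?undup_uniq // => /eqP ij; exact: val_inj.
exists (\sum_(i | P i) eigenspace A t`_i)%MS; split.
  rewrite (mxdirectP (mxdirect_sum_eigenspace A t_inj)) /=.
  rewrite -sum_count_undup leq_eqVlt; apply/orP; left; apply/eqP.
  by apply: eq_bigr => i _; rewrite -mup_char_poly_symmetric // Aeigs mu_prod_XsubC.
move=> v /sub_sumsmxP[u vE].
pose w i := u i *m eigenspace A t`_i.
have wA i : w i *m A = t`_i *: w i by apply/eigenspaceP; rewrite submxMl.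
have {}vE : v = \sum_(i | P i) w i by [].
have vM : v *m (A - lam%:M) = \sum_(i | P i) (t`_i - lam) *: w i.
  rewrite vE mulmx_suml; apply: eq_bigr => i _.
  by rewrite mulmxBr wA mul_mx_scalar scalerBl.
have -> : s * (v *m (A - lam%:M) *m v^T) 0 0 =
    \sum_(i | P i) s * (t`_i - lam) * (w i *m (w i)^T) 0 0.
  rewrite vM mulmx_suml summxE mulr_sumr; apply: eq_bigr => i Pi.
  rewrite -scalemxAl mxE mulrA; congr (_ * _).
  rewrite vE linear_sum mulmx_sumr summxE (bigD1 i) //= big1 ?addr0 // => j /andP[_ ji].
  rewrite (eigenspace_orthogonal A_sym _ (wA i) (wA j)) ?mxE //.
  by rewrite nth_uniq ?undup_uniq // eq_sym.
move=> form_nneg; rewrite vM; apply: big1 => i Pi.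
have term_le0 j : P j -> 0 <= - (s * (t`_j - lam) * (w j *m (w j)^T) 0 0).
  by move=> Pj; rewrite oppr_ge0 mulr_le0_ge0 // form_ge0.
have : \sum_(j | P j) - (s * (t`_j - lam) * (w j *m (w j)^T) 0 0) == 0.
  by rewrite eq_le sumr_ge0 // sumrN oppr_le0 form_nneg.
rewrite psumr_eq0 // => /allP/(_ i); rewrite mem_index_enum Pi oppr_eq0 !mulf_eq0.
rewrite (negPf s0) => /(_ isT)/orP[/eqP ->|/eqP/form_eq0 ->].
  by rewrite scale0r.
by rewrite scaler0.
Qed.

(** * Coordinate subspaces *)

(** The row space consists of the vectors supported in [S]; right multiplication by the transpose
    restricts to the coordinates in [S]. *)
Definition coord_mx (R : realFieldType) (n : nat) (S : {set 'I_n}) : 'M[R]_(#|S|, n) :=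
  rowsub enum_val 1%:M.

Arguments coord_mx R {n} S.

Lemma mulmx_coord_tr (R : realFieldType) (m n : nat) (S : {set 'I_n})
    (B : 'M[R]_(m, n)) i j :
  (B *m (coord_mx R S)^T) i j = B i (enum_val j).
Proof.
rewrite mxE (bigD1 (enum_val j)) //= big1 ?addr0 => [|k kj]; rewrite !mxE.
  by rewrite eqxx mulr1.
by rewrite eq_sym (negPf kj) mulr0.
Qed.

Lemma coord_mxK (R : realFieldType) (n : nat) (S : {set 'I_n}) :
  coord_mx R S *m (coord_mx R S)^T = 1%:M.
Proof.
by apply/matrixP => i j; rewrite mulmx_coord_tr !mxE (inj_eq enum_val_inj).
Qed.

Lemma coord_mx_free (R : realFieldType) (n : nat) (S : {set 'I_n}) :
  row_free (coord_mx R S).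
Proof. by apply/row_freeP; exists (coord_mx R S)^T; exact: coord_mxK. Qed.

Lemma rank_coord_mx (R : realFieldType) (n : nat) (S : {set 'I_n}) :
  \rank (coord_mx R S) = #|S|.
Proof. exact/eqP/coord_mx_free. Qed.

Lemma mulmx_coord_tr_eq0P (R : realFieldType) (n : nat) (S : {set 'I_n})
    (v : 'rV[R]_n) :
  v *m (coord_mx R S)^T = 0 <-> forall x, x \in S -> v 0 x = 0.
Proof.
split=> [vS x xS|vS].
  by have := mulmx_coord_tr v 0 (enum_rank_in xS x); rewrite vS enum_rankK_in // mxE.
by apply/rowP => j; rewrite mulmx_coord_tr mxE vS // enum_valP.
Qed.

Lemma sub_coord_mxP (R : realFieldType) (n : nat) (S : {set 'I_n}) (v : 'rV[R]_n) :
  reflect (forall x, x \notin S -> v 0 x = 0) (v <= coord_mx R S)%MS.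
Proof.
apply: (iffP submxP) => [[u ->] x xS|vS].
  rewrite mxE big1 // => i _; rewrite !mxE.
  case: eqP => [ix|_]; last by rewrite mulr0.
  by rewrite -ix enum_valP in xS.
exists (v *m (coord_mx R S)^T); apply/rowP => x; rewrite mxE.
have [xS|xS] := boolP (x \in S).
  rewrite (bigD1 (enum_rank_in xS x)) //= big1 ?addr0 => [|i ix].
    by rewrite mulmx_coord_tr !mxE enum_rankK_in // eqxx mulr1.
  rewrite !mxE; case: eqP => [ix'|_]; last by rewrite mulr0.
  by case/eqP: ix; apply: enum_val_inj; rewrite ix' enum_rankK_in.
rewrite vS // big1 // => i _; rewrite !mxE.
case: eqP => [ix|_]; last by rewrite mulr0.
by rewrite -ix enum_valP in xS.
Qed.

(** Orthogonality becomes an inclusion of row spaces, which can be checked on each summand of a sum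
    of spaces. *)
Lemma mulmx_tr_eq0 (F : fieldType) (m n : nat) (v : 'rV[F]_n) (C : 'M[F]_(m, n)) :
  (v *m C^T == 0) = (C <= kermx v^T)%MS.
Proof. by rewrite (sameP sub_kermxP eqP) -(inj_eq trmx_inj) trmx_mul trmxK trmx0. Qed.

(** * Vectors proportional to [g] along edges *)

Definition proportional_along (R : realFieldType) (n : nat) (e : rel 'I_n)
    (g : 'I_n -> R) (v : 'rV[R]_n) : Prop :=
  (forall x, g x = 0 -> v 0 x = 0) /\ (forall x y, e x y -> g x * v 0 y = v 0 x * g y).

(** For an edge [x y], row [y] is a normal vector of the hyperplane [g x * v 0 y = v 0 x * g y]. *)
Definition edge_mx (R : realFieldType) (n : nat) (e : rel 'I_n) (g : 'I_n -> R)
    (x : 'I_n) : 'M[R]_n :=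
  \matrix_(y, j) ((e x y)%:R * (g y * (j == x)%:R - g x * (j == y)%:R)).

(* The coordinates off the support of [g] are included so that the orthogonal of
[edge_space e g] is exactly [proportional_along e g]. *)
Definition edge_space (R : realFieldType) (n : nat) (e : rel 'I_n) (g : 'I_n -> R) :
    'M[R]_n :=
  (\sum_x edge_mx e g x + coord_mx R [set x | g x == 0])%MS.

Lemma edge_space_orthP (R : realFieldType) (n : nat) (e : rel 'I_n) (g : 'I_n -> R)
    (v : 'rV[R]_n) :
  v *m (edge_space e g)^T = 0 <-> proportional_along e g v.
Proof.
have vE x y : (v *m (edge_mx e g x)^T) 0 y = (e x y)%:R * (v 0 x * g y - g x * v 0 y).
  rewrite mxE; under eq_bigr do rewrite !mxE mulrCA mulrBr.
  rewrite -mulr_sumr sumrB; congr (_ * (_ - _)).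
    rewrite (bigD1 x) //= big1 ?addr0 => [|k kx]; first by rewrite eqxx mulr1.
    by rewrite (negPf kx) !mulr0.
  rewrite (bigD1 y) //= big1 ?addr0 => [|k kx]; first by rewrite eqxx mulr1 mulrC.
  by rewrite (negPf kx) !mulr0.
rewrite (rwP eqP) /edge_space mulmx_tr_eq0 addsmx_sub -(mulmx_tr_eq0 _ (coord_mx _ _)).
split.
  case/andP=> /sumsmx_subP ve /eqP/mulmx_coord_tr_eq0P vO; split=> x.
    by move=> gx; apply: vO; rewrite inE gx.
  move=> y exy; have := ve x isT; rewrite -mulmx_tr_eq0 => /eqP/rowP/(_ y).
  by rewrite vE exy mul1r mxE => /eqP; rewrite subr_eq0 => /eqP.
case=> vO ve; apply/andP; split; last first.
  by apply/eqP/mulmx_coord_tr_eq0P => x; rewrite inE => /eqP /vO.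
apply/sumsmx_subP => x _; rewrite -mulmx_tr_eq0; apply/eqP/rowP => y; rewrite vE mxE.
by have [/ve ->|_] := boolP (e x y); rewrite ?subrr ?mulr0 ?mul0r.
Qed.

(** A normal vector of the edge [x y] has entries [g y] at [x] and [- g x] at [y]; multiplying by
    [g] turns them into opposite numbers, that is, a flow along the edge. The same factor kills the
    coordinates where [g] vanishes. *)
Lemma edge_space_flow (R : realFieldType) (n : nat) (e : rel 'I_n) (g : 'I_n -> R)
    (v : 'rV[R]_n) :
  symmetric e -> (v <= edge_space e g)%MS ->
  exists w : 'I_n -> 'I_n -> R, [/\ forall x y, w y x = - w x y,
    forall x y, w x y != 0 -> e x y & forall x, g x * v 0 x = \sum_y w x y].
Proof.
move=> e_sym /sub_addsmxP[[a b] /= ->].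
have /sub_sumsmxP[u ->] := submxMl a (\sum_x edge_mx e g x)%MS.
exists (fun x y => g x * g y * ((e x y)%:R * (u x 0 y - u y 0 x))); split.
- by move=> x y; rewrite e_sym; ring.
- by move=> x y; case: (e x y); rewrite // mul0r mulr0 eqxx.
move=> x; rewrite mxE mulrDr [X in _ + X](_ : _ = 0) ?addr0; last first.
  have [->|gx] := eqVneq (g x) 0; first by rewrite mul0r.
  have := submxMl b (coord_mx R [set x | g x == 0]).
  by move/sub_coord_mxP => ->; rewrite ?mulr0 // inE.
rewrite summxE.
have uE z : (u z *m edge_mx e g z) 0 x =
    (z == x)%:R * (\sum_y u x 0 y * (e x y)%:R * g y) - u z 0 x * (e x z)%:R * g z.
  rewrite mxE; under eq_bigr do rewrite !mxE mulrA mulrBr.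
  rewrite sumrB; congr (_ - _).
    rewrite (eq_sym z); have [->|_] := eqVneq x z.
      by rewrite mul1r; apply: eq_bigr => y _; rewrite mulr1.
    by rewrite mul0r big1 // => y _; rewrite !mulr0.
  rewrite (bigD1 x) //= big1 ?addr0 => [|k kx]; first by rewrite eqxx mulr1 e_sym.
  by rewrite eq_sym (negPf kx) !mulr0.
rewrite (eq_bigr _ (fun z _ => uE z)).
rewrite sumrB -mulr_suml (bigD1 x) //= big1 ?addr0 => [|k /negPf -> //].
rewrite eqxx mul1r mulrBr !mulr_sumr -sumrB; apply: eq_bigr => y _; ring.
Qed.

Lemma connect_invariant (T : finType) (T' : Type) (e : rel T) (phi : T -> T') x y :
  (forall a b, e a b -> phi a = phi b) -> connect e x y -> phi x = phi y.
Proof.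
move=> e_phi /connectP[p + ->]; elim: p x => //= z p IHp x /andP[/e_phi -> /IHp].
by [].
Qed.

(** The family counted by [strong_nodal_count], for an arbitrary relation, so that it also covers
    the components of the support. *)
Definition nodal_classes (R : realFieldType) (n : nat) (e : rel 'I_n)
    (g : 'I_n -> R) : {set {set 'I_n}} :=
  [set [set y | connect e x y] | x in [set x | g x != 0]].

(** The restrictions of [g] to the classes, which are the rows of [C], form a basis of the vectors
    proportional to [g] along the edges. *)
Lemma rank_edge_space (R : realFieldType) (n : nat) (e : rel 'I_n) (g : 'I_n -> R) :
  symmetric e -> (forall x y, e x y -> g x != 0) ->
  \rank (kermx (edge_space e g)^T) = #|nodal_classes e g|.
Proof.
move=> e_sym e_supp; set cls := nodal_classes e g.
have classP D x : D \in cls -> x \in D -> g x != 0 /\ D = [set y | connect e x y].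
  case/imsetP=> x0 + ->; rewrite !inE => gx0 x0x; split.
    rewrite -(connect_invariant (phi := fun x => g x != 0) _ x0x) // => a b ab.
    by rewrite (e_supp a b) // (e_supp b a) // e_sym.
  by apply/setP => y; rewrite !inE (same_connect (sym_connect_sym e_sym) x0x).
have mem_class D : D \in cls -> exists x, x \in D.
  by case/imsetP=> x0 _ ->; exists x0; rewrite inE connect0.
pose cl (i : 'I_#|cls|) : {set 'I_n} := enum_val i.
have cl_cls i : cl i \in cls by exact: enum_valP.
pose C : 'M[R]_(#|cls|, n) := \matrix_(i, j) ((j \in cl i)%:R * g j).
have CE (u : 'rV_#|cls|) i x : x \in cl i -> (u *m C) 0 x = u 0 i * g x.
  move=> xi; rewrite mxE (bigD1 i) //= big1 ?addr0 => [|j ji].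
    by rewrite mxE xi mul1r.
  rewrite mxE; have [xj|_] := boolP (x \in _); last by rewrite mul0r mulr0.
  have [_ Di] := classP _ _ (cl_cls i) xi.
  have [_ Dj] := classP _ _ (cl_cls j) xj.
  by case/eqP: ji; apply: enum_val_inj; rewrite -/(cl i) -/(cl j) Di Dj.
have C_free : row_free C.
  rewrite -kermx_eq0 -submx0; apply/rV_subP => u /sub_kermxP uC.
  rewrite submx0; apply/eqP/rowP => i; rewrite mxE.
  have [x xi] := mem_class _ (cl_cls i).
  have [gx _] := classP _ _ (cl_cls i) xi.
  have /eqP := CE u i x xi; rewrite uC mxE eq_sym mulf_eq0 (negPf gx) orbF.
  by move/eqP.
have inC x : g x != 0 -> exists i : 'I_#|cls|, x \in cl i.
  move=> gx; have xc : [set y | connect e x y] \in cls by apply: imset_f; rewrite inE.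
  by exists (enum_rank_in xc [set y | connect e x y]); rewrite /cl enum_rankK_in // inE connect0.
rewrite -(eqP C_free); apply/eqP; rewrite eqn_leq; apply/andP; split; apply: mxrankS.
  apply/rV_subP => v /sub_kermxP/edge_space_orthP[vO ve].
  (* The coefficient on a class is the common value of [v / g] there; classes are nonempty, so the
     default 0 is never reached. *)
  pose u := \row_i (if [pick x in cl i] is Some x
                    then v 0 x / g x else 0) : 'rV_#|cls|.
  suff -> : v = u *m C by exact: submxMl.
  apply/rowP => x; have [gx|gx] := eqVneq (g x) 0.
    by rewrite vO // mxE big1 // => i _; rewrite !mxE gx !mulr0.
  have [i xi] := inC x gx; rewrite (CE u i x xi) mxE.
  case: pickP => [y yi|/(_ x)]; last by rewrite xi.
  have [gy Di] := classP _ _ (cl_cls i) yi.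
  have yx : connect e y x by move: xi; rewrite Di inE.
  rewrite (connect_invariant (phi := fun x => v 0 x / g x) _ yx) ?divfK // => a b ab.
  have ga := e_supp a b ab; have gb : g b != 0 by apply: e_supp; rewrite e_sym; exact: ab.
  by apply/eqP; rewrite eqr_div // -ve // mulrC.
apply/rV_subP => v /submxP[u ->]; apply/sub_kermxP/edge_space_orthP; split=> [x gx|x y exy].
  by rewrite mxE big1 // => i _; rewrite mxE gx !mulr0.
have [i xi] := inC x (e_supp _ _ exy).
have yi : y \in cl i.
  by have [_ ->] := classP _ _ (cl_cls i) xi; rewrite inE connect1.
by rewrite (CE u i x xi) (CE u i y yi); ring.
Qed.

(* A vector of both edge spaces is, up to the factor [g], the divergence of a
flow along [e1] and of a flow along [e2]; their difference has no divergence, so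
both flows vanish and the vector lives on the zeros of [g]. *)
Lemma nodal_classes_split (R : realFieldType) (n : nat) (e e1 e2 : rel 'I_n)
    (g : 'I_n -> R) :
  no_cycle e -> irreflexive e -> symmetric e1 -> symmetric e2 ->
  subrel e1 e -> subrel e2 e ->
  (forall x y, e1 x y -> ~~ e2 x y) ->
  (forall x y, e1 x y || e2 x y -> g x != 0) ->
  (#|nodal_classes e1 g| + #|nodal_classes e2 g| =
   #|[set x | (g x != 0)%R]| + #|nodal_classes (relU e1 e2) g|)%N.
Proof.
move=> acyclic e_irr e1_sym e2_sym e1e e2e e12 supp.
have supp1 x y : e1 x y -> g x != 0 by move=> xy; apply: (supp x y); rewrite xy.
have supp2 x y : e2 x y -> g x != 0 by move=> xy; apply: (supp x y); rewrite xy orbT.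
set N := [set x | g x != 0].
have capE : (edge_space e1 g :&: edge_space e2 g :=: coord_mx R (~: N))%MS.
  have offE : [set x | g x == 0] = ~: N by apply/setP => x; rewrite !inE negbK.
  apply/eqmxP/andP; split; last first.
    by rewrite sub_capmx /edge_space !offE !addsmxSr.
  apply/rV_subP => v; rewrite sub_capmx => /andP[].
  case/(edge_space_flow e1_sym)=> w1 [w1_anti w1_supp w1_div].
  case/(edge_space_flow e2_sym)=> w2 [w2_anti w2_supp w2_div].
  have w0 : forall x y, w1 x y - w2 x y = 0.
    apply: (forest_flow_eq0 acyclic e_irr) => [x y|x y|x].
    - by rewrite w1_anti w2_anti; ring.
    - have [->|/w1_supp/e1e //] := eqVneq (w1 x y) 0.
      by rewrite sub0r oppr_eq0 => /w2_supp/e2e.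
    - by rewrite sumrB -w1_div -w2_div subrr.
  have w10 x y : w1 x y = 0.
    apply/eqP; apply: contraT => w1xy; have /negP[] := e12 _ _ (w1_supp _ _ w1xy).
    by apply: w2_supp; rewrite -(eqP (_ : w1 x y == w2 x y)) // -subr_eq0 w0.
  apply/sub_coord_mxP => x; rewrite !inE negbK => gx; apply: (mulfI gx).
  by rewrite w1_div mulr0 big1.
have sumE : \rank (kermx (edge_space e1 g + edge_space e2 g)%MS^T) =
    \rank (kermx (edge_space (relU e1 e2) g)^T).
  apply: eqmx_rank; apply/andP.
  suff kerE : forall v : 'rV_n, v *m (edge_space e1 g + edge_space e2 g)%MS^T = 0 <->
      v *m (edge_space (relU e1 e2) g)^T = 0.
    by split; apply/rV_subP => v /sub_kermxP vker; apply/sub_kermxP/kerE.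
  move=> v; rewrite (rwP eqP) mulmx_tr_eq0 addsmx_sub -!mulmx_tr_eq0; split.
    case/andP=> /eqP/edge_space_orthP[vO v1] /eqP/edge_space_orthP[_ v2].
    by apply/edge_space_orthP; split=> // x y /orP[/v1|/v2].
  case/edge_space_orthP => vO v12; apply/andP.
  by split; apply/eqP/edge_space_orthP; split=> // x y xy; apply: v12;
    rewrite /= xy ?orbT.
have relU_sym : symmetric (relU e1 e2) by move=> x y; rewrite /= e1_sym e2_sym.
(* With c the number of classes of the union, the dimension formula reads (n - #1) + (n - #2) = (n -
   c) + (n - |N|), where #1 and #2 count the classes of [e1] and [e2]. *)
have := mxrank_sum_cap (edge_space e1 g) (edge_space e2 g).
rewrite capE rank_coord_mx -!rank_edge_space // -sumE !mxrank_ker !mxrank_tr.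
have := cardsC N; rewrite card_ord.
have := rank_leq_row (edge_space e1 g); have := rank_leq_row (edge_space e2 g).
have := rank_leq_row (edge_space e1 g + edge_space e2 g)%MS.
move: (\rank (_ + _)) (\rank (edge_space e1 g)) (\rank (edge_space e2 g)) #|N| #|~: N|.
lia.
Qed.

(** * The quadratic form as a weighted sum of squared differences *)

(** When the square is expanded, the terms in [phi x ^+ 2] and [phi y ^+ 2] sum to zero because [M]
    kills [g]; the mixed terms give the form. *)
Lemma form_gradient (R : realFieldType) (n : nat) (M : 'M[R]_n)
    (g phi : 'I_n -> R) (v : 'rV[R]_n) :
  M^T = M -> (forall x, \sum_y M x y * g y = 0) -> (forall x, v 0 x = g x * phi x) ->
  (v *m M *m v^T) 0 0 *+ 2 = - \sum_x \sum_y M x y * g x * g y * (phi x - phi y) ^+ 2.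
Proof.
move=> M_sym Mg vE.
have Msym x y : M x y = M y x by rewrite -{1}M_sym mxE.
have formE : (v *m M *m v^T) 0 0 = \sum_x \sum_y M x y * g x * g y * (phi x * phi y).
  rewrite mxE; under eq_bigr => x _.
    rewrite !mxE mulr_suml; under eq_bigr => y _ do rewrite (Msym y x) !vE.
    over.
  by apply: eq_bigr => x _; apply: eq_bigr => y _; ring.
have diag0 : \sum_x \sum_y M x y * g x * g y * phi x ^+ 2 = 0.
  apply: big1 => x _.
  transitivity (g x * phi x ^+ 2 * \sum_y M x y * g y); last by rewrite Mg mulr0.
  by rewrite mulr_sumr; apply: eq_bigr => y _; ring.
have diag0' : \sum_x \sum_y M x y * g x * g y * phi y ^+ 2 = 0.
  rewrite exchange_big -[RHS]diag0; apply: eq_bigr => x _; apply: eq_bigr => y _.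
  by rewrite (Msym y x); ring.
rewrite formE; set F := \sum_x \sum_y _ * (phi x * phi y).
suff -> : \sum_x \sum_y M x y * g x * g y * (phi x - phi y) ^+ 2 =
    \sum_x \sum_y M x y * g x * g y * phi x ^+ 2
    + \sum_x \sum_y M x y * g x * g y * phi y ^+ 2 - F *+ 2.
  by rewrite diag0 diag0' addr0 sub0r opprK.
rewrite -sumrMnl -big_split -sumrB /=; apply: eq_bigr => x _.
rewrite -sumrMnl -big_split -sumrB /=; apply: eq_bigr => y _.
by ring.
Qed.

(** A term of [form_gradient] with the wrong sign belongs to an edge of [e], along which [v / g] is
    constant, so it is zero. *)
Lemma form_semidefinite (R : realFieldType) (n : nat) (M : 'M[R]_n) (s : R)
    (e : rel 'I_n) (g : 'I_n -> R) (v : 'rV[R]_n) :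
  M^T = M -> (forall x, \sum_y M x y * g y = 0) ->
  (forall x y, x != y -> 0 < s * (M x y * g x * g y) -> e x y) ->
  proportional_along e g v -> 0 <= s * (v *m M *m v^T) 0 0.
Proof.
move=> M_sym Mg e_pos [vO ve]; pose phi x := v 0 x / g x.
have vE x : v 0 x = g x * phi x.
  have [gx|gx] := eqVneq (g x) 0; first by rewrite vO // gx mul0r.
  by rewrite mulrC divfK.
rewrite -(@pmulrn_lge0 _ _ 2) // -mulrnAr (form_gradient M_sym Mg vE) mulrN -mulNr.
rewrite mulr_sumr; apply: sumr_ge0 => x _; rewrite mulr_sumr; apply: sumr_ge0 => y _.
rewrite mulrA; have [|pos] := leP (s * (M x y * g x * g y)) 0.
  by move=> npos; rewrite mulr_ge0 ?sqr_ge0 // mulNr oppr_ge0.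
have [->|xy] := eqVneq x y; first by rewrite subrr expr0n mulr0.
have gx : g x != 0 by apply: contraTneq pos => ->; rewrite mulr0 mul0r mulr0 ltxx.
have gy : g y != 0 by apply: contraTneq pos => ->; rewrite !mulr0 ltxx.
suff -> : phi x = phi y by rewrite subrr expr0n mulr0.
by apply/eqP; rewrite /phi eqr_div // -ve 1?mulrC //; apply: e_pos.
Qed.

(** * Kernels on a forest and the dimension bounds *)

(** The flow [w] has divergence [g a * (v *m M) 0 a - v 0 a * (M g) a] at [a]. The second term is
    zero, and in the first one of the two factors is. *)
Lemma forest_kernel (R : realFieldType) (n : nat) (e : rel 'I_n) (M : 'M[R]_n)
    (g : 'I_n -> R) (v : 'rV[R]_n) :
  no_cycle e -> irreflexive e -> (forall x y, x != y -> M x y != 0 -> e x y) ->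
  M^T = M -> (forall x, \sum_y M x y * g y = 0) ->
  (forall x, g x != 0 -> (v *m M) 0 x = 0) ->
  forall x y, M x y != 0 -> g x * v 0 y = v 0 x * g y.
Proof.
move=> acyclic e_irr supp M_sym Mg vM x y Mxy.
have Msym a b : M a b = M b a by rewrite -{1}M_sym mxE.
pose w a b := M a b * (g a * v 0 b - v 0 a * g b).
suff /eqP : w x y = 0 by rewrite mulf_eq0 (negPf Mxy) subr_eq0 => /eqP.
apply: (forest_flow_eq0 acyclic e_irr) => [a b|a b|a].
- by rewrite /w Msym; ring.
- rewrite mulf_eq0 negb_or => /andP[Mab wab]; apply: supp Mab.
  by apply: contraNneq wab => ->; rewrite mulrC subrr.
transitivity (g a * (v *m M) 0 a - v 0 a * \sum_b M a b * g b).
  rewrite mxE !mulr_sumr -sumrB; apply: eq_bigr => b _.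
  by rewrite /w (Msym b a); ring.
rewrite Mg mulr0 subr0; have [->|/vM ->] := eqVneq (g a) 0; first by rewrite mul0r.
by rewrite mulr0.
Qed.

Section Nullity.

Variables (R : realFieldType) (n : nat) (e : rel 'I_n) (M : 'M[R]_n).
Variables (g : 'I_n -> R) (T : {set 'I_n}).
Hypotheses (acyclic : no_cycle e) (e_irr : irreflexive e).
Hypothesis M_supp : forall x y, x != y -> M x y != 0 -> e x y.
Hypotheses (M_sym : M^T = M) (Mg : forall x, \sum_y M x y * g y = 0).
(** Together with [NT_nbr] this makes the complement of [T] the set of zeros of [g] all of whose
    neighbours are zeros. *)
Hypothesis T_nbr : forall x, x \in T -> g x = 0 -> exists2 y, M x y != 0 & g y != 0.
Hypothesis NT_nbr : forall x, x \notin T -> forall y, x = y \/ M x y != 0 -> g y = 0.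

Let N := [set x | g x != 0].
(* [L] is the kernel of [M] on vectors supported in [N]: the equations indexed by
[~: T] hold automatically (see [kerNP]). *)
Let L := (coord_mx R N :&: kermx (M *m (coord_mx R T)^T))%MS.

Let Msym x y : M x y = M y x.
Proof. by rewrite -{1}M_sym mxE. Qed.

Let kerNP (v : 'rV_n) : reflect ((forall x, g x = 0 -> v 0 x = 0) /\ v *m M = 0)
  (v <= L)%MS.
Proof.
apply: (iffP idP) => [|[vO vM]]; rewrite sub_capmx.
  case/andP=> /sub_coord_mxP vN /sub_kermxP; rewrite mulmxA => /mulmx_coord_tr_eq0P vM.
  have vO x : g x = 0 -> v 0 x = 0 by move=> gx; apply: vN; rewrite inE gx eqxx.
  split=> //; apply/rowP => x; rewrite [RHS]mxE.
  have [/vM //|xT] := boolP (x \in T).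
  rewrite mxE big1 // => y _.
  have [->|Mxy] := eqVneq (M y x) 0; first by rewrite mulr0.
  by rewrite vO ?mul0r // (NT_nbr xT) // Msym; right.
apply/andP; split; last by apply/sub_kermxP; rewrite mulmxA vM mul0mx.
by apply/sub_coord_mxP => x; rewrite inE negbK => /eqP /vO.
Qed.

Let vanish_off_N (v : 'rV_n) :
  (v <= coord_mx R T)%MS -> (forall x, g x != 0 -> (v *m M) 0 x = 0) ->
  forall x, g x = 0 -> v 0 x = 0.
Proof.
move=> /sub_coord_mxP vT vM x gx; have [xT|/vT //] := boolP (x \in T).
have [y Mxy gy] := T_nbr xT gx.
have := forest_kernel acyclic e_irr M_supp M_sym Mg vM Mxy.
by rewrite gx mul0r => /esym/eqP; rewrite mulf_eq0 (negPf gy) orbF => /eqP.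
Qed.

(** The blocks of [M] on [T] x [N] and [N] x [T] are transposes of each other, so rank-nullity
    applied to both compares their left kernels: the proportional vectors and [L]. *)
Lemma rank_nodal_kernel (e' : rel 'I_n) :
  (forall x y, e' x y -> M x y != 0) ->
  (forall x y, x != y -> M x y != 0 -> g x != 0 -> g y != 0 -> e' x y) ->
  (#|T| + \rank L = #|N| + \rank (kermx (edge_space e' g)^T))%N.
Proof.
move=> e'M Me'; set K := kermx _.
have KE : \rank (coord_mx R T :&: kermx (M *m (coord_mx R N)^T)) = \rank K.
  apply: eqmx_rank; apply/andP; split; apply/rV_subP => v.
    rewrite sub_capmx => /andP[vT /sub_kermxP]; rewrite mulmxA.
    move=> /mulmx_coord_tr_eq0P vM.
    have {}vM x : g x != 0 -> (v *m M) 0 x = 0 by move=> gx; apply: vM; rewrite inE.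
    apply/sub_kermxP/edge_space_orthP; split; first exact: vanish_off_N.
    move=> x y /e'M.
    exact: forest_kernel acyclic e_irr M_supp M_sym Mg vM _ _.
  move=> /sub_kermxP/edge_space_orthP[vO ve]; rewrite sub_capmx; apply/andP; split.
    apply/sub_coord_mxP => x xT; apply/vO/(NT_nbr xT); by left.
  apply/sub_kermxP; rewrite mulmxA; apply/mulmx_coord_tr_eq0P => x; rewrite inE => gx.
  (* Proportionality turns [g x * (v *m M) 0 x] term by term into [v 0 x] times row [x] of
     [M g = 0]. *)
  apply: (mulfI gx); rewrite mulr0 -[RHS](mulr0 (v 0 x)) -[in RHS](Mg x).
  rewrite mxE !mulr_sumr; apply: eq_bigr => y _; rewrite (Msym y x).
  have [->|Mxy] := eqVneq (M x y) 0; first by rewrite mul0r !mulr0.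
  have [->|xy] := eqVneq x y; first by ring.
  have [gy|gy] := eqVneq (g y) 0; first by rewrite vO // gy !(mul0r, mulr0).
  transitivity (M x y * (g x * v 0 y)); first by ring.
  by rewrite ve ?Me' //; ring.
have rankT := mxrank_mul_ker (coord_mx R T) (M *m (coord_mx R N)^T).
have rankN := mxrank_mul_ker (coord_mx R N) (M *m (coord_mx R T)^T).
have rankE : \rank (coord_mx R T *m (M *m (coord_mx R N)^T)) =
    \rank (coord_mx R N *m (M *m (coord_mx R T)^T)).
  by rewrite -mxrank_tr !trmx_mul !trmxK M_sym mulmxA.
move: rankT rankN; rewrite KE rankE !rank_coord_mx -/L.
by move: (\rank (_ *m _)) (\rank L) (\rank K) => a b c <- <-; rewrite addnAC.
Qed.

(** Extension by zero embeds the kernel of the submatrix; [vanish_off_N] places the image in [L]. *)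
Lemma rank_principal_kernel :
  \rank (kermx (coord_mx R T *m M *m (coord_mx R T)^T)) = \rank L.
Proof.
rewrite -(mxrankMfree _ (coord_mx_free R T)).
apply: eqmx_rank; apply/andP; split; apply/rV_subP => v.
  move=> /submxP[u ->]; have := mulmx_ker (coord_mx R T *m M *m (coord_mx R T)^T).
  move: (kermx _) => k kM; set v' := u *m _.
  have vT : (v' <= coord_mx R T)%MS by rewrite /v' mulmxA submxMl.
  have vM : forall x, x \in T -> (v' *m M) 0 x = 0.
    apply/mulmx_coord_tr_eq0P.
    by rewrite /v' -!mulmxA [coord_mx _ _ *m _]mulmxA kM mulmx0.
  have vO : forall x, g x = 0 -> v' 0 x = 0.
    apply: vanish_off_N => // x gx; apply: vM; apply: contraNT gx => xT.
    by apply/eqP/(NT_nbr xT); left.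
  rewrite /L sub_capmx; apply/andP; split.
    by apply/sub_coord_mxP => x; rewrite inE negbK => /eqP/vO.
  by apply/sub_kermxP; rewrite mulmxA; apply/mulmx_coord_tr_eq0P.
move=> /kerNP[vO vM].
have /submxP[u vE] : (v <= coord_mx R T)%MS.
  by apply/sub_coord_mxP => x xT; apply/vO/(NT_nbr xT); left.
rewrite vE submxMr //; apply/sub_kermxP.
by rewrite !mulmxA -vE vM mul0mx.
Qed.

Lemma rank_nodal_kernel_le : (\rank L <= \rank (kermx M))%N.
Proof. by apply/mxrankS/rV_subP => v /kerNP[_ vM]; apply/sub_kermxP. Qed.

(** On proportional vectors the scaled form is nonnegative, so those lying in [W] are killed by [M]
    and belong to [L]; the dimension formula concludes. *)
Lemma courant_bound (W : 'M[R]_n) (e' : rel 'I_n) (s : R) :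
  (forall v : 'rV_n, (v <= W)%MS -> 0 <= s * (v *m M *m v^T) 0 0 -> v *m M = 0) ->
  (forall x y, x != y -> 0 < s * (M x y * g x * g y) -> e' x y) ->
  (\rank W + \rank (kermx (edge_space e' g)^T) <= n + \rank L)%N.
Proof.
move=> W_ker e'_pos; rewrite -mxrank_sum_cap leq_add ?rank_leq_col //.
apply/mxrankS/rV_subP => v; rewrite sub_capmx => /andP[/W_ker vW].
move=> /sub_kermxP/edge_space_orthP v_prop; apply/kerNP; split; first by case: v_prop.
exact/vW/(form_semidefinite M_sym Mg e'_pos v_prop).
Qed.

End Nullity.

(** * Eigenvalue counts, edge signs and the final arithmetic *)

Lemma count_nth_ge (T : eqType) (x0 : T) (p : pred T) (s : seq T) (i j : nat) :
  (j <= size s)%N -> (forall m, (i <= m < j)%N -> p (nth x0 s m)) ->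
  (j - i <= count p s)%N.
Proof.
move=> js ps; have [ij|/ltnW/eqP-> //] := leqP i j.
have sz : size (take (j - i) (drop i s)) = (j - i)%N.
  by rewrite size_takel // size_drop leq_sub2r.
have sub_s := subseq_trans (take_subseq (drop i s) (j - i)) (drop_subseq s i).
apply: leq_trans (leq_count_subseq p sub_s).
suff : all p (take (j - i) (drop i s)) by rewrite all_count sz => /eqP ->.
apply/(all_nthP x0) => m; rewrite sz => mij.
by rewrite nth_take // nth_drop ps // leq_addr -ltn_subRL.
Qed.

Lemma principal_submxE (R : realType) (n : nat) (A : 'M[R]_n) (S : {set 'I_n}) :
  principal_submx A S = coord_mx R S *m A *m (coord_mx R S)^T.
Proof.
apply/matrixP => i j; rewrite mulmx_coord_tr !mxE (bigD1 (enum_val i)) //= big1.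
  by rewrite !mxE eqxx mul1r addr0.
by move=> k ki; rewrite !mxE eq_sym (negPf ki) mul0r.
Qed.

Lemma sgn_form (R : realType) (n : nat) (A : 'M[R]_n) (f : 'I_n -> R) (s : R) x y :
  adj A x y && (0 < f x * (s * sgn_edge A x y) * f y) =
  (x != y) && (0 < - s * (A x y * f x * f y)).
Proof.
rewrite /adj /sgn_edge -andbA; congr (_ && _).
have [->|Axy] := eqVneq (A x y) 0; first by rewrite !mul0r mulr0 ltxx.
rewrite (_ : _ * _ * _ = - s * (A x y * f x * f y) * `|A x y|^-1); last by ring.
by rewrite pmulr_lgt0 // invr_gt0 normr_gt0.
Qed.

Lemma eq_nodal_classes (R : realFieldType) (n : nat) (e1 e2 : rel 'I_n) (g : 'I_n -> R) :
  e1 =2 e2 -> nodal_classes e1 g = nodal_classes e2 g.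
Proof.
by move=> e12; apply: eq_imset => x; apply/setP => y; rewrite !inE (eq_connect e12).
Qed.

Theorem theorem5p2 (R : realType) (n : nat) (A : 'M[R]_n)
  (eigs : seq R) (k r : nat) (lam : R) (f : 'cV[R]_n) :
  A^T = A ->
  no_cycle (adj A) ->
  (* eigs = the eigenvalues of A listed with multiplicity, nondecreasing *)
  sorted <=%R eigs ->
  char_poly A = \prod_(x <- eigs) ('X - x%:P) ->
  (* lambda_k (1-based index k) has multiplicity r, with
     l_1 <= ... <= l_{k-1} < l_k = ... = l_{k+r-1} < l_{k+r} <= ... <= l_n *)
  (1 <= k)%N -> (1 <= r)%N -> (k + r - 1 <= n)%N ->
  (forall i : nat, (i < k - 1)%N -> eigs`_i < lam) ->
  (forall i : nat, (k - 1 <= i < k + r - 1)%N -> eigs`_i = lam) ->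
  (forall i : nat, (k + r - 1 <= i < n)%N -> lam < eigs`_i) ->
  (* f is an eigenfunction for lambda_k *)
  f != 0 -> A *m f = lam *: f ->
  let fk := fun x : 'I_n => f x 0 in
  let F := [set x | (fk x == 0) && [forall y, adj A x y ==> (fk y == 0)]] in
  let rt := mup lam (char_poly (principal_submx A (~: F))) in
  let S := strong_nodal_count (adj A) (sgn_edge A) fk in
  let Sbar := strong_nodal_count (adj A) (fun x y => - sgn_edge A x y) fk in
  (rt <= r)%N /\
  (exists c1 c2 : nat,
     (c1 + c2 + (r - rt) = #|F|)%N /\
     (S + #|F| = k + r - 1 + c1)%N /\
     (Sbar + #|F| = n - k + 1 + c2)%N) /\
  (F = set0 -> S = (k + r - 1)%N /\ Sbar = (n - k + 1)%N).

Proof.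
move=> A_sym acyclic eigs_sorted Aeigs k1 r1 krn eigs_lt eigs_eq eigs_gt f0 Af.
move=> fk F rt S Sbar.
have size_eigs : size eigs = n.
  have := size_prod_XsubC eigs id; rewrite -Aeigs size_char_poly.
  by case.
pose M := A - lam%:M.
have M_sym : M^T = M by rewrite /M linearB /= A_sym tr_scalar_mx.
have ME x y : x != y -> M x y = A x y.
  by move=> xy; rewrite !mxE (negPf xy) subr0.
have Mf : M *m f = 0 by rewrite mulmxBl Af mul_scalar_mx subrr.
have Mg x : \sum_y M x y * fk y = 0 by have /colP/(_ x) := Mf; rewrite !mxE.
have e_irr : irreflexive (adj A) by move=> x; rewrite /adj eqxx.
have M_supp x y : x != y -> M x y != 0 -> adj A x y.
  by move=> xy; rewrite ME // /adj xy.
have T_nbr x : x \in ~: F -> fk x = 0 -> exists2 y, M x y != 0 & fk y != 0.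
  rewrite !inE => xF fx; move: xF; rewrite fx eqxx negb_forall => /existsP[y].
  by rewrite negb_imply => /andP[/andP[xy Axy] fy]; exists y; rewrite // ME.
have NT_nbr x : x \notin ~: F -> forall y, x = y \/ M x y != 0 -> fk y = 0.
  rewrite !inE negbK => /andP[/eqP fx /forallP xF] y; have [<- //|xy] := eqVneq x y.
  case=> [/eqP|Mxy]; first by rewrite (negPf xy).
  by have /implyP/(_ (M_supp _ _ xy Mxy))/eqP := xF y.
(* [e (- 1)] is the step relation for [S] and [e 1] the one for [Sbar]. *)
pose e (s : R) x y := (x != y) && (0 < s * (A x y * fk x * fk y)).
have e_symm s : symmetric (e s).
  move=> x y; rewrite /e eq_sym -{1}A_sym mxE.
  by rewrite [A y x * _ * _]mulrAC.
have e_adj s : subrel (e s) (adj A).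
  move=> x y /andP[xy]; rewrite /adj xy.
  by apply: contraTneq => ->; rewrite !mul0r mulr0 ltxx.
have e_supp s x y : e s x y -> fk x != 0.
  by move=> /andP[_]; apply: contraTneq => ->; rewrite mulr0 mul0r mulr0 ltxx.
have SE : S = #|nodal_classes (e (- 1)) fk|.
  congr #|pred_of_set _|; apply: eq_nodal_classes => x y.
  by rewrite /Sstep -[sgn_edge A x y]mul1r sgn_form.
have SbarE : Sbar = #|nodal_classes (e 1) fk|.
  congr #|pred_of_set _|; apply: eq_nodal_classes => x y.
  by rewrite /Sstep -[- sgn_edge A x y]mulN1r sgn_form opprK.
pose N := [set x | fk x != 0].
pose L := (coord_mx R N :&: kermx (M *m (coord_mx R (~: F))^T))%MS.
have rtE : rt = \rank L.
  rewrite /rt principal_submxE mup_char_poly_symmetric; last first.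
    by rewrite !trmx_mul trmxK A_sym mulmxA.
  rewrite -(rank_principal_kernel acyclic e_irr M_supp M_sym Mg T_nbr NT_nbr).
  by rewrite /eigenspace /M mulmxBr mulmxBl mul_mx_scalar -scalemxAl coord_mxK scalemx1.
have rE : (\rank L <= r)%N.
  apply: leq_trans (rank_nodal_kernel_le M_sym NT_nbr) _.
  rewrite -/(eigenspace A lam) -mup_char_poly_symmetric // Aeigs mu_prod_XsubC.
  (* At least k - 1 eigenvalues lie below [lam] and n - (k + r - 1) above, which leaves at most r
     equal to it. *)
  have lt_count : (k - 1 - 0 <= count (fun a => a < lam)%R eigs)%N.
    by apply: (count_nth_ge (x0 := 0)) => [|m /andP[_ /eigs_lt //]]; rewrite size_eigs; lia.
  have gt_count : (n - (k + r - 1) <= count (fun a => lam < a)%R eigs)%N.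
    by apply: (count_nth_ge (x0 := 0)) => [|m /eigs_gt //]; rewrite size_eigs.
  have neq_count : (count (fun a => a < lam)%R eigs + count (fun a => lam < a)%R eigs =
      count (predC (pred1 lam)) eigs)%N.
    rewrite -count_predUI [X in (_ + X)%N](_ : _ = 0%N) ?addn0.
      by apply: eq_count => a /=; rewrite -neq_lt.
    by apply/eqP; rewrite -leqn0 leqNgt -has_count; apply/hasPn => a _ /=; case: ltgtP.
  have := count_predC (pred1 lam) eigs; rewrite size_eigs -neq_count.
  move: (count (pred1 lam) eigs) (count _ eigs) (count _ eigs) lt_count gt_count.
  by move: krn k1 r1; clear; lia.
have e_pos s x y : x != y -> 0 < s * (M x y * fk x * fk y) -> e s x y.
  by move=> xy; rewrite ME // /e xy.
have disj x y : e (- 1) x y -> ~~ e 1 x y.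
  rewrite /e mulN1r mul1r oppr_gt0 => /andP[-> neg].
  by rewrite -leNgt ltW.
have U_supp x y : e (- 1) x y || e 1 x y -> fk x != 0 by case/orP => /e_supp.
have := nodal_classes_split acyclic e_irr (e_symm (- 1)) (e_symm 1)
  (e_adj (- 1)) (e_adj 1) disj U_supp.
set U := relU _ _; rewrite -/N -SE -SbarE => SSbar.
have U_sym : symmetric U by move=> x y; rewrite /= !(e_symm _ x).
have UM x y : U x y -> M x y != 0.
  have eM s : e s x y -> M x y != 0.
    by move=> /[dup] /e_adj /andP[xy Axy] _; rewrite ME.
  by case/orP => /eM.
(* Each edge inside the support has one of the two signs, so [U] is the full adjacency there. *)
have MU x y : x != y -> M x y != 0 -> fk x != 0 -> fk y != 0 -> U x y.
  move=> xy; rewrite ME // /U /= /e xy mulN1r mul1r oppr_gt0 => Axy fx fy.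
  by rewrite -neq_lt !mulf_neq0.
have := rank_nodal_kernel acyclic e_irr M_supp M_sym Mg T_nbr NT_nbr UM MU.
rewrite -/N -/L rank_edge_space // -rtE -SSbar => nullity.
have bound s : s != 0 ->
    (count (fun a => s * (a - lam) <= 0)%R eigs + #|nodal_classes (e s) fk|
     <= n + rt)%N.
  move=> s0; have [W [W_rank W_ker]] := semidefinite_subspace lam A_sym Aeigs s0.
  have := courant_bound M_sym Mg NT_nbr W_ker (e_pos s).
  rewrite rank_edge_space ?rtE //; last exact: e_supp.
  by apply: leq_trans; rewrite leq_add2r.
(* Indices start at 0: the eigenvalues at most [lam] occupy positions below k + r - 1. *)
have boundL : (k + r - 1 + Sbar <= n + rt)%N.
  rewrite SbarE; apply: leq_trans (bound 1 (oner_neq0 R)); rewrite leq_add2r.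
  rewrite -[X in (X <= _)%N]subn0; apply: (count_nth_ge (x0 := 0)) => [|m /andP[_ mkr]].
    by rewrite size_eigs.
  rewrite mul1r subr_le0; have [mk|km] := ltnP m (k - 1).
    by rewrite ltW // eigs_lt.
  by rewrite eigs_eq // km.
(* The eigenvalues at least [lam] start at position k - 1. *)
have boundG : (n - k + 1 + S <= n + rt)%N.
  have s0 : - 1 != 0 :> R by rewrite oppr_eq0 oner_neq0.
  rewrite SE; apply: leq_trans (bound (- 1) s0); rewrite leq_add2r.
  have -> : (n - k + 1 = n - (k - 1))%N by lia.
  apply: (count_nth_ge (x0 := 0)) => [|m /andP[km mn]]; first by rewrite size_eigs.
  rewrite mulN1r oppr_le0 subr_ge0; have [mkr|krm] := ltnP m (k + r - 1).
    by rewrite eigs_eq // km.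
  by rewrite ltW // eigs_gt // krm.
have cardF := cardsC F; rewrite card_ord in cardF.
have rt_le_r : (rt <= r)%N by rewrite rtE.
clear -k1 r1 krn SSbar nullity boundL boundG cardF rt_le_r.
have F0 : F = set0 -> #|F| = 0%N by move->; rewrite cards0.
clearbody rt S Sbar.
move: #|F| #|~: F| F0 cardF nullity => m m' F0 cardF nullity.
split=> //; split; last by move=> /F0; lia.
(* Since S + Sbar + m = n + rt, [boundL] and [boundG] ensure that neither subtraction truncates. *)
exists (S + m - (k + r - 1))%N, (Sbar + m - (n - k + 1))%N; lia.
Qed.
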